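(* Let $n\ge 2$ and $d\ge n+1$. Let $\mathbf{A}$ be a degenerate $(n+1)$-simplex in $\mathbb{R}^d$ with vertices $A_1,\dots,A_{n+2}$ and non-degenerate $n$-faces $F_1,\dots,F_{n+2}$, let $X_1,X_2$ be the natural partition of the set of its $n$-faces, and let $\mathbf{B}$ be a dual of $\mathbf{A}$ in $\mathbb{R}^n$ (where $\mathbf{A}$ is restricted to the $n$-dimensional affine subspace containing it, identified with $\mathbb{R}^n$). Assume that the vertices of $\mathbf{B}$ do not lie on an $(n-1)$-dimensional sphere in $\mathbb{R}^n$. Let $\mathbf{A}(t)$, $t\in[0,\varepsilon)$, be a continuous motion of $\mathbf{A}$ in $\mathbb{R}^d$, i.e. the vertices $A_1(t),\dots,A_{n+2}(t)\in\mathbb{R}^d$ are continuous functions of $t$ with $A_i(0)=A_i$, such that all $n$-faces $F_i(t)$ of $\mathbf{A}(t)$ are non-degenerate for every $t$, and suppose that the single volume constraint $$\sum_{F_i\in X_1}V_n(F_i(t))-\sum_{F_i\in X_2}V_n(F_i(t))=0$$ holds for all $t\in[0,\varepsilon)$. Then there is $\delta\in(0,\varepsilon]$ such that for every $t\in[0,\delta)$ the vertices of $\mathbf{A}(t)$ are contained in some $n$-dimensional affine subspace of $\mathbb{R}^d$.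
   Context: A degenerate $(n+1)$-simplex $\mathbf{A}$ in $\mathbb{R}^d$ is given by $n+2$ points (vertices) $A_1,\dots,A_{n+2}$ contained in an $n$-dimensional affine subspace. Its $n$-face $F_i$ (or $F_i(t)$ for $\mathbf{A}(t)$) is the $n$-simplex whose vertices are all the vertices except the $i$-th one; the $n$-faces are non-degenerate when any $n+1$ of the vertices are affinely independent. $V_n$ is $n$-dimensional volume. Natural partition: up to a constant factor there is a unique sequence of non-zero reals $\alpha_1,\dots,\alpha_{n+2}$ with $\sum\alpha_iA_i=0$ and $\sum\alpha_i=0$. The $n$-faces form a double covering of the convex hull of the vertices, which partitions them into two subsets $X_1$ and $X_2$; it is the partition induced by Radon's theorem, i.e. $F_i$ and $F_j$ are in the same subset if and only if $\alpha_i$ and $\alpha_j$ have the same sign. One has $\sum_{X_1}V_n(F_i)=\sum_{X_2}V_n(F_i)$. Dual: with $\mathbf{A}$ restricted to $\mathbb{R}^n$, a degenerate $(n+1)$-simplex $\mathbf{B}$ in $\mathbb{R}^n$ (with non-degenerate $n$-faces, i.e. any $n+1$ of its $n+2$ vertices are affinely independent) with vertices $B_1,\dots,B_{n+2}$ is called a dual of $\mathbf{A}$ if $\overrightarrow{A_iA_j}\cdot\overrightarrow{B_kB_l}=0$ for all distinct $i,j,k,l\in\{1,\dots,n+2\}$. *)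

(* Defs.v *)
From HB Require Import structures.
From mathcomp Require Import all_boot all_order all_algebra.
From mathcomp Require Import all_classical all_reals all_analysis.

Set Implicit Arguments.
Unset Strict Implicit.
Unset Printing Implicit Defensive.

Import Order.TTheory GRing.Theory Num.Theory.
Import numFieldNormedType.Exports.

Local Open Scope ring_scope.

(* The library norm on matrices is the sup norm, so Euclidean notions are     *)
(* expressed through this inner product.                                      *)
Definition dot (R : realType) (d : nat) (u v : 'rV[R]_d) : R :=
  (u *m v^T) 0 0.

Definition affinely_independent (R : realType) (m d : nat)
    (P : 'I_m -> 'rV[R]_d) : Prop :=
  forall c : 'I_m -> R,
    \sum_i c i = 0 -> \sum_i c i *: P i = 0 -> forall i, c i = 0.

(* The subspace is p + (row space of W).                                      *)
Definition in_affine_subspace (R : realType) (k m d : nat)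
    (P : 'I_m -> 'rV[R]_d) : Prop :=
  exists (p : 'rV[R]_d) (W : 'M[R]_(k, d)),
    \rank W = k /\ forall i, (P i - p <= W)%MS.

Definition degenerate_simplex (R : realType) (n d : nat)
    (A : 'I_n.+2 -> 'rV[R]_d) : Prop :=
  in_affine_subspace n A.

Definition face (R : realType) (n d : nat) (A : 'I_n.+2 -> 'rV[R]_d)
    (i : 'I_n.+2) : 'I_n.+1 -> 'rV[R]_d :=
  fun j => A (lift i j).

Definition nondegenerate_faces (R : realType) (n d : nat)
    (A : 'I_n.+2 -> 'rV[R]_d) : Prop :=
  forall i, affinely_independent (face A i).

(* n-dimensional volume of an n-simplex in R^d: 1/n! times the n-volume of    *)
(* the parallelepiped on its edge vectors at P_0, i.e. the square root of     *)
(* their Gram determinant.                                                    *)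
Definition edge_mx (R : realType) (n d : nat) (P : 'I_n.+1 -> 'rV[R]_d) :
    'M[R]_(n, d) :=
  \matrix_(k < n) (P (lift ord0 k) - P ord0).

Definition simplex_volume (R : realType) (n d : nat)
    (P : 'I_n.+1 -> 'rV[R]_d) : R :=
  Num.sqrt (\det (edge_mx P *m (edge_mx P)^T)) / n`!%:R.

(* Each n-face is represented by the index of the vertex it omits.  Both      *)
(* parts are automatically nonempty, since \sum_i alpha i = 0.                *)
Definition natural_partition (R : realType) (n d : nat)
    (A : 'I_n.+2 -> 'rV[R]_d) (X1 X2 : {set 'I_n.+2}) : Prop :=
  exists alpha : 'I_n.+2 -> R,
    [/\ forall i, alpha i != 0,
        \sum_i alpha i *: A i = 0,
        \sum_i alpha i = 0,
        X2 = ~: X1 &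
        forall i j, (i \in X1) = (j \in X1) <->
                    Num.sg (alpha i) = Num.sg (alpha j)].

(* A' is A read in R^n through the isometric affine embedding                 *)
(* x |-> p + x *m U of R^n into R^d (U has orthonormal rows).                 *)
Definition restricted_to (R : realType) (n d : nat)
    (A : 'I_n.+2 -> 'rV[R]_d) (A' : 'I_n.+2 -> 'rV[R]_n) : Prop :=
  exists (p : 'rV[R]_d) (U : 'M[R]_(n, d)),
    U *m U^T = 1%:M /\ forall i, A i = p + A' i *m U.

Definition is_dual (R : realType) (n : nat) (A B : 'I_n.+2 -> 'rV[R]_n) :
    Prop :=
  [/\ degenerate_simplex B,
      nondegenerate_faces B &
      forall i j k l, uniq [:: i; j; k; l] ->
        dot (A j - A i) (B l - B k) = 0].

(* The points lie on a sphere of codimension 1 in R^n.                        *)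
Definition on_sphere (R : realType) (m n : nat) (P : 'I_m -> 'rV[R]_n) :
    Prop :=
  exists (c : 'rV[R]_n) (r : R),
    0 < r /\ forall i, dot (P i - c) (P i - c) = r ^+ 2.

(* Main.v *)
Require Import Defs.
From HB Require Import structures.
From mathcomp Require Import all_boot all_order all_algebra.
From mathcomp Require Import perm.
From mathcomp Require Import all_classical all_reals all_analysis.
From mathcomp Require Import ring.

Set Implicit Arguments.
Unset Strict Implicit.
Unset Printing Implicit Defensive.

Import Order.TTheory GRing.Theory Num.Theory.
Import numFieldNormedType.Exports.

Local Open Scope classical_set_scope.
Local Open Scope ring_scope.

(** Single out the vertex [A_0] (the apex); the other [n + 1] vertices span
    the base face.  Let [b] be the barycentric coordinates, in the base, of the
    orthogonal projection of [A_0], and let [s] be the squared distance of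
    [A_0] to the base.  The [n + 2] points are degenerate exactly when [s = 0].

    Squared volumes are affine in [s].  With [D] the Gram determinant of the
    base and [Q_i] the one of its facet opposite to the [i]-th base vertex, the
    face omitting that vertex has Gram determinant [b_i ^ 2 * D + s * Q_i]
    ([gram_apex_face_foot]).  Write [sg_i] for the sign of [b_i].  For [s = 0]
    the volume constraint holds automatically, because [sum_i b_i = 1].
    Subtracting this identity from the constraint and rationalizing the
    square roots leaves
      [s * sum_i sg_i * Q_i / (sqrt (b_i ^ 2 * D + s * Q_i)
                               + |b_i| * sqrt D) = 0].
    As [t] tends to [0] the sum tends to a nonzero multiple of
    [sum_i Q_i / b_i], taken at the initial configuration.  If that number is
    nonzero, then [s] vanishes for all small [t] ([flat_of_first_order]).

    The number [sum_i Q_i / b_i] is read off the dual.  In [R^n] one has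
    [Q_i = D * |g_i| ^ 2], where [g_i] is the gradient of the [i]-th barycentric
    coordinate of the base.  Duality makes [B_i - B_0] orthogonal to the facet
    on which this coordinate is constant, so it is a multiple of [g_i], and the
    remaining orthogonality relations force [B_i - B_0 = (lam / b_i) g_i] with
    one common [lam].  Hence [sum_i Q_i / b_i = 0] says that the affine
    dependency [b] of the points [B_i] annihilates [|B_i - B_0| ^ 2] too, which
    happens only if these squared norms are a linear function of
    [B_i - B_0], that is, if the points [B_i] lie on a sphere
    ([dual_on_sphere]). *)

(** * Squared volumes as bordered Gram determinants *)

(** For [u] the all-ones column, [- \det (bordered_gram u P)] is the Gram
    determinant of the edges of the simplex whose vertices are the rows of [P]
    (a Cayley-Menger determinant).  Unlike the edge matrix it treats all the
    vertices alike, so no base vertex has to be chosen coherently for different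
    faces.  The border [u] is kept general so that row operations can act on
    it. *)
Definition bordered_gram (R : comPzRingType) (m d : nat) (u : 'cV[R]_m)
    (P : 'M[R]_(m, d)) : 'M[R]_(1 + m) :=
  block_mx 0 u^T u (P *m P^T).

Lemma det_bordered_gram_mul (R : comPzRingType) (m d : nat) (L : 'M[R]_m)
    (u : 'cV[R]_m) (P : 'M[R]_(m, d)) :
  \det (bordered_gram (L *m u) (L *m P)) =
  \det L ^+ 2 * \det (bordered_gram u P).
Proof.
have -> : bordered_gram (L *m u) (L *m P) =
    block_mx 1%:M 0 0 L *m bordered_gram u P *m block_mx 1%:M 0 0 (L^T).
  rewrite /bordered_gram !mulmx_block !(mul0mx, mulmx0, mul1mx, mulmx1).
  by rewrite !(addr0, add0r) !trmx_mul !mulmxA.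
rewrite !det_mulmx !det_ublock det1 det_tr !mul1r; ring.
Qed.

(** After the base vertex has been subtracted from all the other ones, the
    border is the first basis vector; swapping the first two rows then makes
    the matrix block triangular. *)
Lemma det_bordered_gram_pointed (R : comPzRingType) (m d : nat)
    (p : 'rV[R]_d) (E : 'M[R]_(m, d)) :
  \det (bordered_gram (col_mx 1%:M 0 : 'cV_(1 + m)) (col_mx p E)) =
  - \det (E *m E^T).
Proof.
set K := bordered_gram _ _.
pose a : 'I_(1 + (1 + m)) := lshift (1 + m) ord0.
pose b : 'I_(1 + (1 + m)) := rshift 1 (lshift m ord0).
have EK : K = block_mx 0 (row_mx 1%:M 0) (col_mx 1%:M 0)
    (block_mx (p *m p^T) (p *m E^T) (E *m p^T) (E *m E^T)).
  by rewrite /K /bordered_gram !tr_col_mx mul_col_row trmx0 trmx1.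
have Exrow : xrow a b K =
    block_mx 1%:M (row_mx (p *m p^T) (p *m E^T)) 0
      (block_mx 1%:M 0 (E *m p^T) (E *m E^T)) :> 'M[R]_(1 + (1 + m)).
  rewrite EK; apply/matrixP => i j; rewrite mxE.
  case: (split_ordP i) => [i0|i1] -> {i}.
    rewrite ord1 tpermL /b.
    case: (split_ordP j) => [j0|j1] ->.
      by rewrite block_mxEdl block_mxEul col_mxEu.
    rewrite block_mxEdr block_mxEur.
    by case: (split_ordP j1) => [j2|j2] ->;
      rewrite ?block_mxEur ?block_mxEul ?row_mxEl ?row_mxEr.
  case: (split_ordP i1) => [i2|i2] -> {i1}.
    rewrite ord1 tpermR /a.
    case: (split_ordP j) => [j0|j1] ->.
      by rewrite block_mxEdl block_mxEul !mxE.
    rewrite block_mxEdr block_mxEur.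
    by case: (split_ordP j1) => [j2|j2] ->;
      rewrite ?block_mxEur ?block_mxEul ?row_mxEl ?row_mxEr ?mxE.
  rewrite tpermD ?eq_lshift ?eq_rshift ?eq_lrshift ?eq_rlshift //.
  case: (split_ordP j) => [j0|j1] ->.
    by rewrite !block_mxEdl col_mxEd !mxE.
  by rewrite !block_mxEdr;
    case: (split_ordP j1) => [j2|j2] ->; rewrite ?block_mxEdl ?block_mxEdr.
have : \det (xrow a b K) = \det (E *m E^T).
  by rewrite Exrow det_ublock det_lblock !det1 !mul1r.
rewrite xrowE det_mulmx /tperm_mx det_perm odd_tperm eq_lrshift expr1 mulN1r.
by move=> <-; rewrite opprK.
Qed.

Lemma gram_edge_mx (R : realType) (n d : nat) (P : 'I_n.+1 -> 'rV[R]_d) :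
  \det (edge_mx P *m (edge_mx P)^T) =
  - \det (bordered_gram (const_mx 1) (\matrix_i P i)).
Proof.
pose L : 'M[R]_(1 + n) := block_mx 1%:M 0 (const_mx 1) 1%:M.
have EP : \matrix_(i < 1 + n) P i = L *m col_mx (P ord0) (edge_mx P).
  rewrite mul_block_col !mul1mx mul0mx addr0.
  apply/matrixP => i j; rewrite [LHS]mxE.
  case: (split_ordP i) => [i0|i1] ->.
    rewrite col_mxEu ord1; congr (P _ 0 j); exact: val_inj.
  rewrite col_mxEd !mxE big_ord1 !mxE mul1r.
  rewrite addrC subrK; congr (P _ 0 j); exact: val_inj.
have Eu : (const_mx 1 : 'cV[R]_(1 + n)) = L *m (col_mx 1%:M 0 : 'cV_(1 + n)).
  rewrite mul_block_col !mulmx1 !mulmx0 !addr0.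
  apply/matrixP => i j; rewrite [LHS]mxE.
  case: (split_ordP i) => [i0|i1] ->; first by rewrite col_mxEu !ord1 mxE.
  by rewrite col_mxEd mxE.
rewrite EP Eu (det_bordered_gram_mul L) det_bordered_gram_pointed.
by rewrite det_lblock !det1 mulr1 expr1n mul1r opprK.
Qed.

Lemma mulmx_trE (R : comPzRingType) (m n p : nat) (X : 'M[R]_(m, p))
    (Y : 'M[R]_(n, p)) j k :
  (X *m Y^T) j k = (row j X *m (row k Y)^T) 0 0.
Proof. by rewrite !mxE; apply: eq_bigr => l _; rewrite !mxE. Qed.

Lemma det_add_delta (R : comPzRingType) (m : nat) (N : 'M[R]_m) (s : R)
    (i : 'I_m) :
  \det (N + s *: delta_mx i i) = \det N + s * cofactor N i i.
Proof.
have cofE j : cofactor (N + s *: delta_mx i i) i j = cofactor N i j.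
  rewrite /cofactor; congr (_ * \det _); apply/matrixP => a b.
  by rewrite !mxE eq_sym (negPf (neq_lift _ _)) mulr0 addr0.
rewrite !(expand_det_row _ i).
under eq_bigr do rewrite cofE !mxE eqxx /= mulrDl.
rewrite big_split /=; congr (_ + _).
rewrite (bigD1 i) //= eqxx mulr1 big1 ?addr0 // => j /negPf ->.
by rewrite mulr0 mul0r.
Qed.

Lemma det_replace_row_id (R : comPzRingType) (m : nat) (x : 'rV[R]_m)
    (i : 'I_m) :
  \det (\matrix_(j, k) (if j == i then x 0 k else (j == k)%:R)) = x 0 i.
Proof.
set M := \matrix_(j, k) _.
have cofE j : cofactor M i j = (i == j)%:R.
  transitivity (cofactor (1%:M : 'M[R]_m) i j).
    rewrite /cofactor; congr (_ * \det _); apply/matrixP => a b.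
    by rewrite !mxE eq_sym (negPf (neq_lift _ _)).
  by have /matrixP/(_ j i) := @adj1 R m; rewrite !mxE eq_sym.
rewrite (expand_det_row _ i) (bigD1 i) //= cofE eqxx mulr1 mxE eqxx.
by rewrite big1 ?addr0 // => j ji; rewrite cofE eq_sym (negPf ji) mulr0.
Qed.

(** Replacing the [i]-th of the vectors with Gram matrix [K] by [w + h], where
    [w] is the combination of these vectors with coefficients [x] and [h] is
    orthogonal to all of them, changes the Gram matrix into this one, with [c]
    the square of [w + h].  Thus [c - x K x^T] is the square of [h], the only
    term not coming from the congruence by the row replacement. *)
Lemma det_replace_index (R : comPzRingType) (m : nat) (K : 'M[R]_m)
    (x : 'rV[R]_m) (c : R) (i : 'I_m) :
  K^T = K ->
  \det (\matrix_(j, k) (if j == i then if k == i then c else (x *m K) 0 k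
                        else if k == i then (x *m K) 0 j else K j k)) =
  x 0 i ^+ 2 * \det K + (c - (x *m K *m x^T) 0 0) * cofactor K i i.
Proof.
move=> symK.
pose M := \matrix_(j, k) (if j == i then x 0 k else (j == k)%:R) : 'M[R]_m.
have rowM j : row j M = if j == i then x else delta_mx 0 j.
  by apply/rowP => k; rewrite !mxE; case: eqP => //; rewrite mxE eqxx eq_sym.
have MKM j k : (M *m K *m M^T) j k =
    if j == i then if k == i then (x *m K *m x^T) 0 0 else (x *m K) 0 k
    else if k == i then (x *m K) 0 j else K j k.
  have -> : (M *m K *m M^T) j k = (row j M *m K *m (row k M)^T) 0 0.
    by rewrite mulmx_trE row_mul.
  rewrite !rowM; case: eqP => _; case: eqP => _ //.
  - by rewrite trmx_delta -colE mxE.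
  - rewrite -[_ *m x^T]trmxK mxE !trmx_mul trmxK symK trmx_delta mulmxA.
    by rewrite -colE mxE.
  - by rewrite trmx_delta -colE -rowE !mxE.
set K' := \matrix_(j, k) _.
have -> : K' = M *m K *m M^T + (c - (x *m K *m x^T) 0 0) *: delta_mx i i.
  apply/matrixP => j k; rewrite [LHS]mxE [RHS]mxE MKM !mxE.
  by do 2 case: eqP => _ /=; rewrite ?mulr0 ?addr0 // mulr1 addrC subrK.
rewrite det_add_delta !det_mulmx det_tr det_replace_row_id.
have -> : cofactor (M *m K *m M^T) i i = cofactor K i i.
  rewrite /cofactor; congr (_ * \det _); apply/matrixP => a b.
  by rewrite [LHS]mxE [LHS]mxE MKM !(eq_sym _ i) !(negPf (neq_lift _ _)) !mxE.
by congr (_ + _); ring.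
Qed.

(** * The height of the apex over the base face *)

Definition base_mx (R : realType) (n d : nat) (A : 'I_n.+2 -> 'rV[R]_d) :
    'M[R]_(n.+1, d) :=
  \matrix_i A (lift ord0 i).

Definition base_gram (R : realType) (n d : nat) (A : 'I_n.+2 -> 'rV[R]_d) :
    'M[R]_(1 + n.+1) :=
  bordered_gram (const_mx 1) (base_mx A).

Definition apex_gram (R : realType) (n d : nat) (A : 'I_n.+2 -> 'rV[R]_d) :
    'rV[R]_(1 + n.+1) :=
  row_mx 1%:M (A ord0 *m (base_mx A)^T).

(** [foot A] solves the linear system of the orthogonal projection of the apex
    onto the affine hull of the base: its entries of index [rshift 1 i] are the
    barycentric coordinates of the projection, and its first entry is the
    Lagrange multiplier of the condition that they sum to [1]. *)
Definition foot (R : realType) (n d : nat) (A : 'I_n.+2 -> 'rV[R]_d) :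
    'rV[R]_(1 + n.+1) :=
  apex_gram A *m invmx (base_gram A).

Definition sq_height (R : realType) (n d : nat) (A : 'I_n.+2 -> 'rV[R]_d) : R :=
  dot (A ord0) (A ord0) - (foot A *m (apex_gram A)^T) 0 0.

Lemma base_gram_tr (R : realType) (n d : nat) (A : 'I_n.+2 -> 'rV[R]_d) :
  (base_gram A)^T = base_gram A.
Proof. by rewrite /base_gram tr_block_mx trmx_mul !trmxK trmx0. Qed.

Lemma gram_base_face (R : realType) (n d : nat) (A : 'I_n.+2 -> 'rV[R]_d) :
  \det (edge_mx (face A ord0) *m (edge_mx (face A ord0))^T) =
  - \det (base_gram A).
Proof. exact: gram_edge_mx. Qed.

(** Up to a permutation of its vertices, the face omitting base vertex [i] is
    the base with the apex substituted at position [i]. *)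
Lemma gram_apex_face (R : realType) (n d : nat) (A : 'I_n.+2 -> 'rV[R]_d)
    (i : 'I_n.+1) :
  \det (edge_mx (face A (lift ord0 i)) *m (edge_mx (face A (lift ord0 i)))^T) =
  - \det (bordered_gram (const_mx 1)
      (\matrix_j (if j == i then A ord0 else A (lift ord0 j)))).
Proof.
pose w (j : 'I_n.+1) : 'I_n.+2 := if j == i then ord0 else lift ord0 j.
pose f (j : 'I_n.+1) := odflt ord0 (unlift (lift ord0 i) (w j)).
have fK j : lift (lift ord0 i) (f j) = w j.
  rewrite /f; case: unliftP => [k -> //|]; rewrite /w.
  case: eqP => [_ /eqP|ji]; first by rewrite (negPf (neq_lift _ _)).
  by move/lift_inj.
have injf : injective f.
  move=> j k fjk; have : w j = w k by rewrite -!fK fjk.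
  rewrite /w; case: eqP => [->|_]; case: eqP => [->|_] //.
  exact: lift_inj.
have -> : \matrix_j (if j == i then A ord0 else A (lift ord0 j)) =
    perm_mx (perm injf) *m \matrix_j face A (lift ord0 i) j.
  rewrite -row_permE; apply/matrixP => j k.
  by rewrite !mxE permE /face fK /w; case: ifP.
have Eu : const_mx 1 = perm_mx (perm injf) *m (const_mx 1 : 'cV[R]_n.+1).
  by rewrite -row_permE; apply/matrixP => j k; rewrite !mxE.
by rewrite Eu det_bordered_gram_mul det_perm sqrr_sign mul1r gram_edge_mx.
Qed.

(** The apex is its projection, a combination of the base vertices, plus a
    vector orthogonal to the base, so [det_replace_index] applies to its
    substitution for a base vertex. *)
Lemma gram_apex_face_foot (R : realType) (n d : nat)
    (A : 'I_n.+2 -> 'rV[R]_d) (i : 'I_n.+1) :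
  base_gram A \in unitmx ->
  \det (edge_mx (face A (lift ord0 i)) *m (edge_mx (face A (lift ord0 i)))^T) =
  foot A 0 (rshift 1 i) ^+ 2 * - \det (base_gram A) +
  sq_height A * - cofactor (base_gram A) (rshift 1 i) (rshift 1 i).
Proof.
move=> unitK; rewrite gram_apex_face !mulrN -opprD; congr (- _).
have footK : foot A *m base_gram A = apex_gram A by rewrite mulmxKV.
rewrite /sq_height -footK trmx_mul base_gram_tr mulmxA.
rewrite -det_replace_index ?base_gram_tr //; congr (\det _).
rewrite footK; apply/matrixP => j k; rewrite [RHS]mxE /bordered_gram.
case: (split_ordP j) => [j0|j1] ->; case: (split_ordP k) => [k0|k1] ->;
  rewrite ?(eq_lrshift, eq_rlshift, eq_rshift) /=
    ?(block_mxEul, block_mxEur, block_mxEdl, block_mxEdr).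
- by [].
- case: ifP => [_|_]; last by rewrite !mxE.
  by rewrite /apex_gram row_mxEl !mxE !ord1.
- by case: ifP => [_|_]; rewrite /apex_gram ?row_mxEl !mxE ?ord1.
rewrite /apex_gram !row_mxEr /dot.
have E l : row l (\matrix_j (if j == i then A ord0 else A (lift ord0 j))) =
    if l == i then A ord0 else row l (base_mx A).
  by rewrite rowK; case: ifP => // _; rewrite rowK.
rewrite mulmx_trE !E; case: ifP => _; case: ifP => _ //.
- by rewrite [RHS]mulmx_trE row_id.
- by rewrite -[_ *m (A ord0)^T]trmxK mxE trmx_mul trmxK [RHS]mulmx_trE row_id.
- by rewrite -mulmx_trE.
Qed.

(** * The inner product *)

Lemma dotE (R : realType) (d : nat) (u v : 'rV[R]_d) :
  dot u v = \sum_j u 0 j * v 0 j.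
Proof. by rewrite /dot mxE; apply: eq_bigr => j _; rewrite mxE. Qed.

Lemma dotC (R : realType) (d : nat) (u v : 'rV[R]_d) : dot u v = dot v u.
Proof. by rewrite !dotE; apply: eq_bigr => j _; rewrite mulrC. Qed.

Lemma dotBl (R : realType) (d : nat) (u v w : 'rV[R]_d) :
  dot (u - v) w = dot u w - dot v w.
Proof. by rewrite /dot mulmxBl !mxE. Qed.

Lemma dotBr (R : realType) (d : nat) (u v w : 'rV[R]_d) :
  dot w (u - v) = dot w u - dot w v.
Proof. by rewrite !(dotC w) dotBl. Qed.

Lemma dotZl (R : realType) (d : nat) (a : R) (u v : 'rV[R]_d) :
  dot (a *: u) v = a * dot u v.
Proof. by rewrite /dot -scalemxAl mxE. Qed.

Lemma dotZr (R : realType) (d : nat) (a : R) (u v : 'rV[R]_d) :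
  dot v (a *: u) = a * dot v u.
Proof. by rewrite !(dotC v) dotZl. Qed.

Lemma dot_ge0 (R : realType) (d : nat) (u : 'rV[R]_d) : 0 <= dot u u.
Proof. by rewrite dotE; apply: sumr_ge0 => j _; rewrite -expr2 sqr_ge0. Qed.

Lemma dot_eq0 (R : realType) (d : nat) (u : 'rV[R]_d) : dot u u = 0 -> u = 0.
Proof.
rewrite dotE => /eqP; rewrite psumr_eq0 => [/allP u0|j _]; last first.
  by rewrite -expr2 sqr_ge0.
apply/rowP => j; have := u0 j (mem_index_enum j).
by rewrite /= mulf_eq0 orbb mxE => /eqP.
Qed.

(** * The foot of the height *)

Lemma foot_decomp (R : realType) (n d : nat) (A : 'I_n.+2 -> 'rV[R]_d) :
  base_gram A \in unitmx ->
  rsubmx (foot A) *m const_mx 1 = 1%:M /\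
  lsubmx (foot A) *m (const_mx 1)^T
    + rsubmx (foot A) *m (base_mx A *m (base_mx A)^T) =
  A ord0 *m (base_mx A)^T.
Proof.
move=> unitK; have : foot A *m base_gram A = apex_gram A by rewrite mulmxKV.
rewrite -{1}(hsubmxK (foot A)) /base_gram /bordered_gram mul_row_block.
by rewrite mulmx0 add0r => /eq_row_mx[-> ->].
Qed.

Lemma foot_sum (R : realType) (n d : nat) (A : 'I_n.+2 -> 'rV[R]_d) :
  base_gram A \in unitmx -> \sum_i foot A 0 (rshift 1 i) = 1.
Proof.
move=> /foot_decomp[/matrixP/(_ 0 0) + _]; rewrite !mxE eqxx mulr1n => <-.
by apply: eq_bigr => i _; rewrite !mxE mulr1.
Qed.

(** The Lagrange multiplier in [foot A] is the inner product of [h] with every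
    base vertex, hence with the projection of the apex. *)
Lemma sq_heightE (R : realType) (n d : nat) (A : 'I_n.+2 -> 'rV[R]_d)
    (h := A ord0 - rsubmx (foot A) *m base_mx A) :
  base_gram A \in unitmx -> sq_height A = dot h h.
Proof.
move=> unitK; have [bu bG] := foot_decomp unitK.
rewrite /sq_height /apex_gram -{1}(hsubmxK (foot A)) tr_row_mx mul_row_col.
move: bu bG; rewrite /h; set a := lsubmx _; set b := rsubmx _ => bu bG.
rewrite trmx1 mulmx1 trmx_mul trmxK.
rewrite /dot.
have -> : (A ord0 - b *m base_mx A) *m (A ord0 - b *m base_mx A)^T =
  A ord0 *m (A ord0)^T - (a + b *m (base_mx A *m (A ord0)^T)).
  rewrite linearB /= mulmxBl !mulmxBr trmx_mul !mulmxA -bG mulmxDl.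
  rewrite -(mulmxA a) -trmx_mul bu trmx1 mulmx1 !mulmxA.
  by rewrite opprB -addrA opprD -addrA addKr opprD.
by rewrite [RHS]mxE [X in _ = _ + X]mxE.
Qed.

Lemma sq_height_degenerate (R : realType) (n d : nat)
    (A : 'I_n.+2 -> 'rV[R]_d) :
  base_gram A \in unitmx -> sq_height A = 0 -> degenerate_simplex A.
Proof.
move=> unitK; rewrite sq_heightE // => /dot_eq0/eqP.
rewrite subr_eq0 => /eqP A0.
have sum1 := foot_sum unitK.
pose W := edge_mx (face A ord0).
exists (A (lift ord0 ord0)), W; split.
  apply/eqP; rewrite eqn_leq rank_leq_row /=.
  apply: leq_trans (mxrankM_maxl W W^T).
  rewrite mxrank_unit // unitmxE gram_base_face unitfE oppr_eq0 -unitfE.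
  by rewrite -unitmxE.
have sub j : (A (lift ord0 j) - A (lift ord0 ord0) <= W)%MS.
  have [k ->|->] := unliftP ord0 j; last by rewrite subrr sub0mx.
  rewrite (_ : _ - _ = row k W) ?row_sub //.
  by apply/rowP => l; rewrite !mxE.
move=> i; have [j ->|->] := unliftP ord0 i; first exact: sub.
have -> : A ord0 - A (lift ord0 ord0) =
    \sum_j foot A 0 (rshift 1 j) *: (A (lift ord0 j) - A (lift ord0 ord0)).
  under eq_bigr do rewrite scalerBr.
  rewrite sumrB -scaler_suml sum1 scale1r.
  rewrite {1}A0 mulmx_sum_row; congr (_ - _).
  by apply: eq_bigr => j _; rewrite mxE rowK.
by apply: summx_sub => j _; apply: scalemx_sub.
Qed.

(** When the apex lies in the affine hull of the base, it is its own projection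
    and the Lagrange multiplier vanishes. *)
Lemma foot_affine_combination (R : realType) (n d : nat)
    (A : 'I_n.+2 -> 'rV[R]_d) (b : 'rV[R]_n.+1) :
  base_gram A \in unitmx -> b *m const_mx 1 = 1%:M ->
  A ord0 = b *m base_mx A -> foot A = row_mx 0 b.
Proof.
move=> unitK bu A0.
suff E : row_mx 0 b *m base_gram A = apex_gram A by rewrite /foot -E mulmxK.
rewrite /base_gram /bordered_gram mul_row_block !mul0mx !add0r bu.
by rewrite mulmxA -A0.
Qed.

(** * Affine bases and the dual simplex *)

(** The barycentric coordinates of [R^n] relative to the points [P i] are the
    affine functions [y |-> a 0 i + dot y (g i)], with gradients [g i] the
    columns of [G]. *)
Lemma affine_basis_inverse (R : realType) (n : nat)
    (P : 'I_n.+1 -> 'rV[R]_n) (X := \matrix_i P i) :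
  affinely_independent P ->
  exists (a : 'rV[R]_n.+1) (G : 'M[R]_(n, n.+1)),
    [/\ a *m X = 0, a *m const_mx 1 = 1%:M, G *m (const_mx 1 : 'cV_n.+1) = 0,
      G *m X = 1%:M & const_mx 1 *m a + X *m G = 1%:M].
Proof.
move=> indP.
pose N : 'M[R]_(1 + n) := row_mx (const_mx 1) X.
have unitN : N \in unitmx.
  rewrite -row_free_unit -kermx_eq0 -submx0; apply/row_subP => i.
  have : row i (kermx N) *m N = 0 by apply/sub_kermxP; exact: row_sub.
  rewrite mul_mx_row -[0 in RHS]row_mx0 => /eq_row_mx[v1 vX].
  rewrite submx0; apply/eqP/rowP => j; rewrite [RHS]mxE.
  apply: (indP (fun j => row i (kermx N) 0 j)).
    rewrite -[RHS](_ : (row i (kermx N) *m (const_mx 1 : 'cV_n.+1)) 0 0 = 0).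
      by rewrite mxE; apply: eq_bigr => k _; rewrite [const_mx _ _ _]mxE mulr1.
    by rewrite v1 mxE.
  rewrite -[RHS]vX mulmx_sum_row.
  by apply: eq_bigr => k _; rewrite rowK.
exists (usubmx (invmx N)), (dsubmx (invmx N)).
have := mulVmx unitN; rewrite -{1}(vsubmxK (invmx N)) mul_col_row.
rewrite -[1%:M]submxK => /eq_block_mx[].
rewrite !scalar_mx_block block_mxKul block_mxKur block_mxKdl block_mxKdr.
move=> -> -> -> ->; split=> //.
by rewrite -mul_row_col vsubmxK -(@scalar_mx_block _ 1 n) (mulmxV unitN).
Qed.

(** The inverse of the Cayley-Menger matrix of a full-dimensional simplex
    contains the Gram matrix of the gradients of the barycentric
    coordinates. *)
Lemma base_gram_inverse (R : realType) (n : nat) (A : 'I_n.+2 -> 'rV[R]_n)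
    (a : 'rV[R]_n.+1) (G : 'M[R]_(n, n.+1)) :
  a *m base_mx A = 0 -> a *m const_mx 1 = 1%:M ->
  G *m (const_mx 1 : 'cV_n.+1) = 0 -> G *m base_mx A = 1%:M ->
  const_mx 1 *m a + base_mx A *m G = 1%:M ->
  base_gram A *m block_mx 0 a a^T (G^T *m G) = 1%:M.
Proof.
move=> aX au Gu GX uaXG.
rewrite /base_gram /bordered_gram mulmx_block !mul0mx !mulmx0 !add0r.
rewrite -trmx_mul au mulmxA -trmx_mul Gu trmx0 mul0mx.
rewrite -mulmxA -trmx_mul aX trmx0 mulmx0.
rewrite !mulmxA -(mulmxA (base_mx A) _ G^T) -trmx_mul GX !trmx1 mulmx1 uaXG.
by rewrite -scalar_mx_block.
Qed.

Lemma on_sphere_const (R : realType) (m n : nat) (P : 'I_m -> 'rV[R]_n)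
    (q : 'rV[R]_n) :
  (0 < n)%N -> (forall i, P i = q) -> on_sphere P.
Proof.
case: n P q => // n P q _ Pq.
pose e : 'rV[R]_n.+1 := delta_mx 0 ord0.
exists (q - e), 1; split=> // i.
by rewrite Pq opprB addrC subrK /dot /e trmx_delta mul_delta_mx !mxE expr1n.
Qed.

(** Applied to the base vertices, of which the dimension bound of the theorem
    provides at least three. *)
Lemma ord_avoid2 (n : nat) (i j : 'I_n) :
  (2 < n)%N -> exists k : 'I_n, (k != i) && (k != j).
Proof.
move=> n_gt2; apply/existsP; apply: contraLR n_gt2 => /existsPn all_ij.
rewrite -leqNgt -[n in (n <= _)%N]card_ord -cardsT.
apply: leq_trans (_ : #|[set i; j]%SET| <= 2)%N; last first.
  by rewrite cards2; case: eqP.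
apply/subset_leq_card/fintype.subsetP => k _; rewrite !inE.
by have := all_ij k; rewrite negb_and !negbK.
Qed.

(** Here [b] are the barycentric coordinates of the apex and the columns of [G]
    the gradients of the barycentric coordinates of the base.  The differences
    [B i - B 0] are the gradients rescaled by [lam / b i]; the sphere passes
    through [B 0], and its center [B 0 + c] solves the linear equations
    [2 c.(B i - B 0) = |B i - B 0| ^ 2], which are compatible under the last
    hypothesis. *)
Lemma dual_on_sphere (R : realType) (n : nat) (A B : 'I_n.+2 -> 'rV[R]_n)
    (a b : 'rV[R]_n.+1) (G : 'M[R]_(n, n.+1)) :
  (2 <= n)%N ->
  G *m (const_mx 1 : 'cV_n.+1) = 0 -> G *m base_mx A = 1%:M ->
  const_mx 1 *m a + base_mx A *m G = 1%:M ->
  b *m const_mx 1 = 1%:M -> A ord0 = b *m base_mx A ->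
  (forall i, b 0 i != 0) ->
  (forall i j k l, uniq [:: i; j; k; l] -> dot (A j - A i) (B l - B k) = 0) ->
  \sum_i (G^T *m G) i i / b 0 i = 0 ->
  on_sphere B.
Proof.
move=> n2 Gu GX uaXG bu A0 b_neq0 dual sum0.
set X := base_mx A in GX uaXG A0.
pose g i : 'rV[R]_n := row i G^T.
have gg i : dot (g i) (g i) = (G^T *m G) i i.
  by rewrite /dot -mulmx_trE trmxK.
have /choice[j0 j0P] : forall i : 'I_n.+1, exists k, k != i.
  by move=> i; have [k /andP[ki _]] := ord_avoid2 i i n2; exists k.
pose x (i : 'I_n.+1) := A (lift ord0 i).
pose v (i : 'I_n.+1) := B (lift ord0 i) - B ord0.
pose l i := dot (v i) (x i - x (j0 i)).
have l0F (i : 'I_n.+1) : (ord0 == lift ord0 i) = false.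
  exact/negbTE/neq_lift.
have lF0 (i : 'I_n.+1) : (lift ord0 i == ord0) = false by rewrite eq_sym l0F.
have llE (i j : 'I_n.+1) : (lift ord0 i == lift ord0 j) = (i == j).
  exact/inj_eq/lift_inj.
(* [v i] has the same inner product with all base vertices but the [i]-th, so
   it is determined by the single number [l i]. *)
have vE i : v i = l i *: g i.
  have vx j : j != i -> dot (v i) (x j) = dot (v i) (x (j0 i)).
    move=> ji; have [->//|jk] := eqVneq j (j0 i).
    apply/eqP; rewrite -subr_eq0 -dotBr dotC; apply/eqP; apply: dual.
    by rewrite /= !inE !(llE, lF0, l0F) (eq_sym _ j) (negPf jk) (negPf (j0P i))
      (negPf ji).
  have -> : v i = v i *m X^T *m G^T.
    by rewrite -mulmxA -trmx_mul GX trmx1 mulmx1.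
  have -> : v i *m X^T =
      dot (v i) (x (j0 i)) *: (const_mx 1)^T + l i *: delta_mx 0 i.
    apply/rowP => j; rewrite mulmx_trE row_id rowK -/(dot _ _) -/(x j).
    rewrite !mxE eqxx /= mulr1.
    have [->|ji] := eqVneq j i; last by rewrite mulr0 addr0 (vx j ji).
    by rewrite mulr1 /l dotBr addrC subrK.
  rewrite mulmxDl -!scalemxAl -trmx_mul Gu trmx0 scaler0 add0r.
  by rewrite -rowE.
have xg i k : dot (x k) (g i) = (k == i)%:R - a 0 i.
  have -> : dot (x k) (g i) = (X *m G) k i.
    by rewrite -[G in RHS]trmxK mulmx_trE rowK.
  have <- : (1%:M - const_mx 1 *m a) k i = (k == i)%:R - a 0 i.
    by rewrite !mxE big_ord1 !mxE mul1r.
  by rewrite -uaXG addrC addKr.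
have A0g i : dot (A ord0) (g i) = b 0 i - a 0 i.
  have sumb : \sum_k b 0 k = 1.
    move/matrixP: bu => /(_ 0 0); rewrite !mxE eqxx mulr1n => E.
    by rewrite -[RHS]E; apply: eq_bigr => k _; rewrite !mxE mulr1.
  rewrite A0 mulmx_sum_row /dot mulmx_suml summxE.
  under eq_bigr => k _ do
    rewrite -scalemxAl mxE rowK -/(dot _ _) xg mulrBr.
  rewrite sumrB -mulr_suml sumb mul1r; congr (_ - _).
  by rewrite (bigD1 i) //= eqxx mulr1 big1 ?addr0 // => k /negPf ->;
    rewrite mulr0.
(* [v i - v j] is orthogonal to the edge joining the apex to a third base
   vertex [k]; on this edge the [i]-th coordinate varies by [b 0 i] and the
   [j]-th by [b 0 j]. *)
have lb i j : l i * b 0 i = l j * b 0 j.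
  have [->//|ij] := eqVneq i j.
  have [k /andP[ki kj]] := ord_avoid2 i j n2.
  have : dot (A ord0 - x k) (v i - v j) = 0.
    rewrite /v opprB addrA subrK; apply: dual.
    by rewrite /= !inE !(llE, lF0, l0F) (negPf ki) (negPf kj) eq_sym (negPf ij).
  rewrite dotBr !vE !dotZr !dotBl !A0g !xg (negPf ki) (negPf kj).
  by move=> /eqP; rewrite !sub0r !opprK !subrK subr_eq0 => /eqP.
pose lam := l ord0 * b 0 ord0.
have lE i : l i = lam / b 0 i by rewrite /lam (lb _ i) mulfK.
(* [m] prescribes the values of [c] on the gradients; as these sum to zero, it
   is attained only if its entries sum to zero, and then by [m *m X]. *)
pose m : 'rV[R]_n.+1 := \row_i (l i * dot (g i) (g i) / 2).
pose c := m *m X.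
have mu : m *m const_mx 1 = 0 :> 'M[R]_1.
  apply/matrixP => i j; rewrite !ord1 mxE [RHS]mxE.
  transitivity (\sum_k lam / 2 * ((G^T *m G) k k / b 0 k)).
    apply: eq_bigr => k _; rewrite [const_mx _ _ _]mxE [m _ _]mxE lE gg.
    by field.
  by rewrite -mulr_sumr sum0 mulr0.
have cg i : dot c (g i) = m 0 i.
  have -> : dot c (g i) = (c *m G) 0 i.
    by rewrite -[G in RHS]trmxK mulmx_trE row_id.
  rewrite /c -mulmxA (_ : X *m G = 1%:M - const_mx 1 *m a).
    by rewrite mulmxBr mulmx1 mulmxA mu mul0mx subr0.
  by rewrite -uaXG addrC addKr.
have vv i : dot (v i) (v i) = 2 * dot c (v i).
  by rewrite vE !dotZr !dotZl cg mxE; field.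
(* For [c = 0] all the points [B i] coincide, and any sphere through that
   point will do. *)
have [c0|c_neq0] := eqVneq c 0.
  apply: (@on_sphere_const _ _ _ _ (B ord0)); first exact: ltnW.
  move=> i; have [j ->|->//] := unliftP ord0 i.
  apply/eqP; rewrite -subr_eq0; apply/eqP/dot_eq0; rewrite -/(v j) vv c0.
  by rewrite /dot mul0mx mxE mulr0.
have cc_gt0 : 0 < dot c c.
  rewrite lt_def dot_ge0 andbT; apply: contra_neq c_neq0; exact: dot_eq0.
exists (B ord0 + c), (Num.sqrt (dot c c)); split; first by rewrite sqrtr_gt0.
move=> i; rewrite sqr_sqrtr ?dot_ge0 // opprD addrA.
have [j ->|->] := unliftP ord0 i.
  rewrite -/(v j); move: (v j) (vv j) => w ww.
  rewrite dotBl !dotBr ww (dotC w); ring.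
by rewrite subrr sub0r /dot linearN /= mulNmx mulmxN opprK.
Qed.

(** The first-order coefficient of the volume constraint at the initial
    configuration is the last sum.  Dividing the cofactors by [\det K] gives the
    diagonal entries of the inverse of [K], which are the squared norms of the
    gradients of the barycentric coordinates, so [dual_on_sphere] applies. *)
Lemma flat_configuration (R : realType) (n : nat) (A B : 'I_n.+2 -> 'rV[R]_n)
    (alpha : 'I_n.+2 -> R) (K := base_gram A) :
  (2 <= n)%N -> affinely_independent (face A ord0) ->
  (forall i, alpha i != 0) ->
  \sum_i alpha i *: A i = 0 -> \sum_i alpha i = 0 ->
  is_dual A B -> ~ on_sphere B ->
  [/\ K \in unitmx, 0 < - \det K, sq_height A = 0,
      forall i, foot A 0 (rshift 1 i) = - alpha (lift ord0 i) / alpha ord0 &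
      \sum_i - cofactor K (rshift 1 i) (rshift 1 i) / foot A 0 (rshift 1 i)
        != 0].
Proof.
move=> n2 indA alpha0 alphaA alpha1 [_ _ dual] notS.
have [a [G []]] := affine_basis_inverse indA.
rewrite -/(base_mx A) => aX au Gu GX uaXG.
have KKi := base_gram_inverse aX au Gu GX uaXG; rewrite -/K in KKi.
have unitK : K \in unitmx by have [] := mulmx1_unit KKi.
pose b : 'rV[R]_n.+1 := \row_i (- alpha (lift ord0 i) / alpha ord0).
have bu : b *m const_mx 1 = 1%:M.
  apply/matrixP => i j; rewrite !ord1 mxE [RHS]mxE eqxx mulr1n.
  transitivity (\sum_k (- (alpha ord0)^-1) * alpha (lift ord0 k)).
    by apply: eq_bigr => k _; rewrite !mxE mulr1 mulNr mulrC mulNr.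
  move: alpha1; rewrite -mulr_sumr big_ord_recl => /eqP.
  by rewrite addrC addr_eq0 => /eqP ->; rewrite mulrNN mulVf.
have A0 : A ord0 = b *m base_mx A.
  rewrite mulmx_sum_row.
  transitivity (- (alpha ord0)^-1 *:
      \sum_k alpha (lift ord0 k) *: A (lift ord0 k)).
    move: alphaA; rewrite big_ord_recl => /eqP.
    rewrite addrC addr_eq0 => /eqP ->.
    by rewrite scaleNr scalerN opprK scalerA mulVf ?scale1r.
  rewrite scaler_sumr; apply: eq_bigr => k _.
  by rewrite scalerA rowK mxE mulNr mulrC mulNr.
have footE := foot_affine_combination unitK bu A0.
have footi i : foot A 0 (rshift 1 i) = - alpha (lift ord0 i) / alpha ord0.
  by rewrite footE row_mxEr mxE.
have detK : 0 < - \det K.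
  rewrite -gram_base_face det_mulmx det_tr -expr2 lt_def sqr_ge0 andbT.
  rewrite expr2 -{2}det_tr -det_mulmx gram_base_face oppr_eq0 -unitfE.
  by rewrite -unitmxE.
split=> //.
  rewrite sq_heightE // footE row_mxKr -A0 subrr /dot mul0mx mxE //.
apply/eqP => sum0; apply: notS.
have cofE i : cofactor K (rshift 1 i) (rshift 1 i) = \det K * (G^T *m G) i i.
  have -> : G^T *m G = drsubmx (invmx K).
    have -> : invmx K = block_mx 0 a a^T (G^T *m G).
      by rewrite -[invmx K]mulmx1 -KKi mulKmx.
    by rewrite block_mxKdr.
  rewrite !mxE /invmx unitK !mxE mulrA mulfV ?mul1r //.
  by rewrite -unitfE -unitmxE.
apply: (dual_on_sphere n2 Gu GX uaXG bu A0 _ dual) => [i|].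
  by rewrite mxE mulf_neq0 ?invr_eq0 ?oppr_eq0.
apply: (mulfI (lt0r_neq0 detK)); rewrite mulr0 -[RHS]sum0 mulr_sumr.
by apply: eq_bigr => i _; rewrite cofE footi [b _ _]mxE mulrA !mulNr.
Qed.

(** The data are computed from inner products, which a linear isometry
    preserves. *)
Lemma bordered_gram_isometry (R : realType) (n d : nat)
    (A : 'I_n.+2 -> 'rV[R]_d) (A' : 'I_n.+2 -> 'rV[R]_n) (U : 'M[R]_(n, d)) :
  U *m U^T = 1%:M -> (forall i, A i = A' i *m U) ->
  [/\ base_gram A = base_gram A', foot A = foot A' &
      sq_height A = sq_height A'].
Proof.
move=> UU AE.
have baseE : base_mx A = base_mx A' *m U.
  by apply/row_matrixP => i; rewrite row_mul !rowK AE.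
have K : base_gram A = base_gram A'.
  rewrite /base_gram /bordered_gram baseE trmx_mul mulmxA -(mulmxA _ U) UU.
  by rewrite mulmx1.
have k : apex_gram A = apex_gram A'.
  by rewrite /apex_gram baseE AE trmx_mul mulmxA -(mulmxA _ U) UU mulmx1.
have f : foot A = foot A' by rewrite /foot K k.
split=> //; rewrite /sq_height f k /dot AE trmx_mul mulmxA -(mulmxA _ U) UU.
by rewrite mulmx1.
Qed.

(** * The first-order argument *)

Lemma cvg_fin_sum (R : realType) (T : Type) (F : set_system T)
    (I : Type) (r : seq I) (P : pred I) (f : I -> T -> R) (l : I -> R) :
  Filter F -> (forall i, P i -> f i t @[t --> F] --> l i) ->
  \sum_(i <- r | P i) f i t @[t --> F] --> \sum_(i <- r | P i) l i.
Proof. exact: (cvg_big add_continuous). Qed.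

Lemma cvg_fin_prod (R : realType) (T : Type) (F : set_system T)
    (I : Type) (r : seq I) (P : pred I) (f : I -> T -> R) (l : I -> R) :
  Filter F -> (forall i, P i -> f i t @[t --> F] --> l i) ->
  \prod_(i <- r | P i) f i t @[t --> F] --> \prod_(i <- r | P i) l i.
Proof. exact: (cvg_big mul_continuous). Qed.

(** [s] factors out of the constraint, and the limit of the other factor is a
    positive multiple of [\sum_i Q0 i / x0 i], hence nonzero. *)
Lemma flat_of_first_order (R : realType) (T : Type) (F : set_system T)
    (I : finType) (x Q : I -> T -> R) (D s : T -> R) (x0 Q0 : I -> R)
    (D0 : R) :
  Filter F ->
  (forall i, x i t @[t --> F] --> x0 i) ->
  (forall i, Q i t @[t --> F] --> Q0 i) ->
  D t @[t --> F] --> D0 -> s t @[t --> F] --> (0 : R) ->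
  0 < D0 -> (forall i, x0 i != 0) -> \sum_i Q0 i / x0 i != 0 ->
  (\forall t \near F, \sum_i x i t = 1) ->
  (\forall t \near F, Num.sqrt (D t) =
     \sum_i Num.sg (x0 i) * Num.sqrt (x i t ^+ 2 * D t + s t * Q i t)) ->
  \forall t \near F, s t = 0.
Proof.
move=> FF cx cQ cD cs D0_gt0 x0_neq0 sum0 near1 nearV.
pose C i t := x i t ^+ 2 * D t + s t * Q i t.
(* [y] is the conjugate that rationalizes the difference of the volume of a
   face and of its value for [s = 0]. *)
pose y i t := Num.sqrt (C i t) + Num.sg (x0 i) * x i t * Num.sqrt (D t).
pose S t := \sum_i Num.sg (x0 i) * Q i t / y i t.
have rD0_gt0 : 0 < Num.sqrt D0 by rewrite sqrtr_gt0.
have cC i : C i t @[t --> F] --> x0 i ^+ 2 * D0.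
  rewrite -[X in _ --> X]addr0 -[X in _ + X](mul0r (Q0 i)).
  apply: cvgD; last exact: cvgM.
  by apply: cvgM => //; rewrite expr2; apply: cvgM.
have crD : Num.sqrt (D t) @[t --> F] --> Num.sqrt D0.
  exact: (cvg_comp _ _ cD (@sqrt_continuous R D0)).
have cy i : y i t @[t --> F] --> `|x0 i| * Num.sqrt D0 *+ 2.
  have -> : `|x0 i| * Num.sqrt D0 *+ 2 =
      Num.sqrt (x0 i ^+ 2 * D0) + Num.sg (x0 i) * x0 i * Num.sqrt D0.
    by rewrite sqrtrM ?sqr_ge0 // sqrtr_sqr -normrEsg mulr2n.
  apply: cvgD; first exact: (cvg_comp _ _ (cC i) (@sqrt_continuous R _)).
  by apply: cvgM => //; apply: cvgM => //; exact: cvg_cst.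
have y0_neq0 i : `|x0 i| * Num.sqrt D0 *+ 2 != 0.
  by rewrite mulrn_eq0 /= mulf_neq0 ?normr_eq0 // lt0r_neq0.
have cS : S t @[t --> F] --> (Num.sqrt D0 *+ 2)^-1 * \sum_i Q0 i / x0 i.
  rewrite mulr_sumr; apply: cvg_fin_sum => i _.
  have -> : (Num.sqrt D0 *+ 2)^-1 * (Q0 i / x0 i) =
      Num.sg (x0 i) * Q0 i / (`|x0 i| * Num.sqrt D0 *+ 2).
    have rD_neq0 := lt0r_neq0 rD0_gt0.
    have sg_neq0 : Num.sg (x0 i) != 0 by rewrite sgr_eq0.
    rewrite normrEsg; field.
    by rewrite rD_neq0 x0_neq0 sg_neq0.
  apply: cvgM; last by apply: cvgV.
  by apply: cvgM => //; exact: cvg_cst.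
have S0_neq0 : (Num.sqrt D0 *+ 2)^-1 * \sum_i Q0 i / x0 i != 0.
  by rewrite mulf_neq0 // invr_eq0 mulrn_eq0 /= lt0r_neq0.
have nearS : \forall t \near F, S t != 0 by exact: (cvgr_neq0 _ cS).
have nearD : \forall t \near F, 0 < D t by exact: (cvgr_gt _ cD).
have nearC : \forall t \near F, forall i, 0 < C i t.
  apply: filter_forall => i; apply: (cvgr_gt _ (cC i)).
  by rewrite mulr_gt0 // lt_def sqr_ge0 sqrf_eq0 x0_neq0.
have neary : \forall t \near F, forall i, y i t != 0.
  by apply: filter_forall => i; exact: (cvgr_neq0 _ (cy i)).
near=> t.
have St : S t != 0 by exact: (near nearS t).
have Dt : 0 < D t by exact: (near nearD t).
have Ct : forall i, 0 < C i t by exact: (near nearC t).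
have yt : forall i, y i t != 0 by exact: (near neary t).
have xt : \sum_i x i t = 1 by exact: (near near1 t).
have Vt : Num.sqrt (D t) = \sum_i Num.sg (x0 i) * Num.sqrt (C i t).
  by exact: (near nearV t).
apply/eqP; rewrite -(mulIr_eq0 _ (mulIf St)); apply/eqP.
have sg2 i : Num.sg (x0 i) * Num.sg (x0 i) = 1.
  by rewrite -expr2 sqr_sg x0_neq0.
have step i : s t * (Num.sg (x0 i) * Q i t / y i t) =
    Num.sg (x0 i) * Num.sqrt (C i t) - x i t * Num.sqrt (D t).
  apply: (mulIf (yt i)); rewrite [in LHS]mulrA mulfVK //.
  have EC : Num.sqrt (C i t) ^+ 2 = x i t ^+ 2 * D t + s t * Q i t.
    by rewrite sqr_sqrtr // ltW.
  have ED : Num.sqrt (D t) ^+ 2 = D t by rewrite sqr_sqrtr // ltW.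
  rewrite /y; move: EC ED (sg2 i).
  move: (Num.sqrt (C i t)) (Num.sqrt (D t)) (Num.sg (x0 i)) => c r e EC ED Ee.
  transitivity (e * (c ^+ 2 - x i t ^+ 2 * r ^+ 2)
    + (e * e - 1) * x i t * r * c); last by ring.
  by rewrite EC ED Ee; ring.
rewrite /S mulr_sumr; under eq_bigr do rewrite step.
by rewrite sumrB -Vt -mulr_suml xt mul1r subrr.
Unshelve. all: by end_near. Qed.

(** * Limits of matrix expressions *)

(** Entrywise convergence, so that everything reduces to limits of real
    functions. *)
Definition mx_cvg (R : realType) (T : Type) (F : set_system T) (m n : nat)
    (M : T -> 'M[R]_(m, n)) (M0 : 'M[R]_(m, n)) : Prop :=
  forall i j, M t i j @[t --> F] --> M0 i j.

Section MatrixLimits.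
Context (R : realType) (T : Type) (F : set_system T) {FF : Filter F}.

Lemma mx_cvg_cst (m n : nat) (M0 : 'M[R]_(m, n)) : mx_cvg F (fun=> M0) M0.
Proof. by move=> i j; exact: cvg_cst. Qed.

Lemma mx_cvg_tr (m n : nat) (M : T -> 'M[R]_(m, n)) M0 :
  mx_cvg F M M0 -> mx_cvg F (fun t => (M t)^T) M0^T.
Proof.
by move=> cM i j; rewrite mxE; under eq_cvg do rewrite mxE; exact: cM.
Qed.

Lemma mx_cvg_mul (m n p : nat) (M : T -> 'M[R]_(m, n)) M0
    (N : T -> 'M[R]_(n, p)) N0 :
  mx_cvg F M M0 -> mx_cvg F N N0 -> mx_cvg F (fun t => M t *m N t) (M0 *m N0).
Proof.
move=> cM cN i j; rewrite mxE; under eq_cvg do rewrite mxE.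
by apply: cvg_fin_sum => k _; apply: cvgM.
Qed.

Lemma mx_cvg_row (m n p : nat) (M : T -> 'M[R]_(m, n)) M0
    (N : T -> 'M[R]_(m, p)) N0 :
  mx_cvg F M M0 -> mx_cvg F N N0 ->
  mx_cvg F (fun t => row_mx (M t) (N t)) (row_mx M0 N0).
Proof.
move=> cM cN i j; case: (split_ordP j) => k ->.
  by rewrite row_mxEl; under eq_cvg do rewrite row_mxEl; exact: cM.
by rewrite row_mxEr; under eq_cvg do rewrite row_mxEr; exact: cN.
Qed.

Lemma mx_cvg_col (m n p : nat) (M : T -> 'M[R]_(m, n)) M0
    (N : T -> 'M[R]_(p, n)) N0 :
  mx_cvg F M M0 -> mx_cvg F N N0 ->
  mx_cvg F (fun t => col_mx (M t) (N t)) (col_mx M0 N0).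
Proof.
move=> cM cN i j; case: (split_ordP i) => k ->.
  by rewrite col_mxEu; under eq_cvg do rewrite col_mxEu; exact: cM.
by rewrite col_mxEd; under eq_cvg do rewrite col_mxEd; exact: cN.
Qed.

Lemma cvg_det (m : nat) (M : T -> 'M[R]_m) M0 :
  mx_cvg F M M0 -> \det (M t) @[t --> F] --> \det M0.
Proof.
move=> cM; apply: cvg_fin_sum => s _.
by apply: cvgM; [exact: cvg_cst|apply: cvg_fin_prod => i _; exact: cM].
Qed.

Lemma cvg_cofactor (m : nat) (M : T -> 'M[R]_m) M0 i j :
  mx_cvg F M M0 -> cofactor (M t) i j @[t --> F] --> cofactor M0 i j.
Proof.
move=> cM; apply: cvgM; first exact: cvg_cst.
apply: cvg_det => a b; rewrite !mxE.
by under eq_cvg do rewrite !mxE; exact: cM.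
Qed.

Lemma mx_cvg_inv (m : nat) (M : T -> 'M[R]_m) M0 :
  M0 \in unitmx -> mx_cvg F M M0 ->
  mx_cvg F (fun t => invmx (M t)) (invmx M0).
Proof.
move=> unitM cM i j.
have det0 : \det M0 != 0 by rewrite -unitfE -unitmxE.
have near_unit : \forall t \near F, \det (M t) != 0.
  by exact: (cvgr_neq0 _ (cvg_det cM)).
have <- : (\det M0)^-1 * cofactor M0 j i = invmx M0 i j.
  by rewrite /invmx unitM !mxE.
have cE : (\det (M t))^-1 * cofactor (M t) j i @[t --> F] -->
    (\det M0)^-1 * cofactor M0 j i.
  apply: cvgM; last exact: cvg_cofactor.
  by apply: cvgV => //; exact: cvg_det.
apply: cvg_trans cE; apply: near_eq_cvg.
near=> t.
rewrite /= /invmx unitmxE unitfE ifT; first by rewrite !mxE.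
exact: (near near_unit t).
Unshelve. all: by end_near. Qed.

Variables (n d : nat) (A : T -> 'I_n.+2 -> 'rV[R]_d) (A0 : 'I_n.+2 -> 'rV[R]_d).
Hypothesis cvgA : forall i, mx_cvg F (A ^~ i) (A0 i).

Let mx_cvg_base : mx_cvg F (fun t => base_mx (A t)) (base_mx A0).
Proof.
by move=> i j; rewrite mxE; under eq_cvg do rewrite mxE; exact: cvgA.
Qed.

Lemma mx_cvg_base_gram : mx_cvg F (fun t => base_gram (A t)) (base_gram A0).
Proof.
apply: mx_cvg_col; apply: mx_cvg_row; try exact: mx_cvg_cst.
by apply: mx_cvg_mul => //; exact: mx_cvg_tr.
Qed.

Let mx_cvg_apex : mx_cvg F (fun t => apex_gram (A t)) (apex_gram A0).
Proof.
apply: mx_cvg_row; first exact: mx_cvg_cst.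
by apply: mx_cvg_mul => //; exact: mx_cvg_tr.
Qed.

Lemma mx_cvg_foot : base_gram A0 \in unitmx ->
  mx_cvg F (fun t => foot (A t)) (foot A0).
Proof.
by move=> unitK; apply: mx_cvg_mul => //; apply: mx_cvg_inv => //;
  exact: mx_cvg_base_gram.
Qed.

Lemma cvg_sq_height : base_gram A0 \in unitmx ->
  sq_height (A t) @[t --> F] --> sq_height A0.
Proof.
move=> unitK; apply: cvgB.
  by apply: (@mx_cvg_mul 1 d 1) => //; exact: mx_cvg_tr.
apply: (@mx_cvg_mul 1 _ 1); first exact: mx_cvg_foot.
exact: mx_cvg_tr.
Qed.

End MatrixLimits.

(** * The motion *)

(** Solving the signed constraint for the base face: relative to that face, the
    sign of a face is the one of the barycentric coordinate
    [- alpha i / alpha 0]. *)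
Lemma partition_balance (R : realType) (n : nat) (alpha V : 'I_n.+2 -> R)
    (X1 X2 : {set 'I_n.+2}) :
  (forall i, alpha i != 0) -> X2 = ~: X1 ->
  (forall i j, (i \in X1) = (j \in X1) <->
               Num.sg (alpha i) = Num.sg (alpha j)) ->
  \sum_(i in X1) V i - \sum_(i in X2) V i = 0 ->
  V ord0 =
    \sum_i Num.sg (- alpha (lift ord0 i) / alpha ord0) * V (lift ord0 i).
Proof.
move=> alpha0 -> sgP bal.
pose e (i : 'I_n.+2) : R := if i \in X1 then 1 else -1.
have sum_e : \sum_i e i * V i = 0.
  rewrite (bigID (fun i => i \in X1)) /= -[RHS]bal -sumrN; congr (_ + _).
    by apply: eq_bigr => i iX; rewrite /e iX mul1r.
  apply: eq_big => [i|i iX]; first by rewrite inE.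
  by rewrite /e (negPf iX) mulN1r.
have sgV : forall x : R, Num.sg x^-1 = Num.sg x.
  by move=> x; case: (sgrP x) => [->|x0|x0]; rewrite ?invr0 ?sgr0 //;
    [rewrite gtr0_sg ?invr_gt0|rewrite ltr0_sg ?invr_lt0].
have sgE j : Num.sg (alpha j) = 1 \/ Num.sg (alpha j) = -1.
  by have := alpha0 j; case: sgrP => // _ _; [left|right].
have ee i : e ord0 * e i = Num.sg (alpha i / alpha ord0).
  rewrite sgrM sgV /e; have [E|nE] := eqVneq (ord0 \in X1) (i \in X1).
    rewrite ((sgP _ _).1 E) E -[RHS]expr2 sqr_sg alpha0.
    by case: ifP; rewrite ?mulr1 ?mulrNN ?mulr1.
  have nsg : Num.sg (alpha ord0) <> Num.sg (alpha i).
    by move/(sgP _ _).2 => E; rewrite E eqxx in nE.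
  transitivity (-1 : R).
    by move: nE; case: ifP; case: ifP => //; rewrite ?mul1r ?mulr1.
  by case: (sgE ord0) (sgE i) nsg => -> [] -> //; rewrite ?mul1r ?mulr1.
move: (congr1 (fun z => e ord0 * z) sum_e).
rewrite mulr0 mulr_sumr big_ord_recl.
rewrite mulrA ee mulfV // sgr1 mul1r => /eqP; rewrite addr_eq0 => /eqP ->.
rewrite -sumrN; apply: eq_bigr => i _.
by rewrite mulrA ee mulNr sgrN mulNr.
Qed.

Lemma within_itv_cvg_at_right (R : realType) (V : topologicalType)
    (f : R -> V) (e : R) :
  0 < e -> {within `[0, e[, continuous f} -> f t @[t --> 0^'+] --> f 0.
Proof.
move=> e_gt0 /(_ 0).
have in0 : `[0, e[%classic (0 : R) by rewrite /= in_itv /= lexx.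
rewrite /continuous_at /nbhs /= -(nbhs_subspace_in in0) => cf.
apply: cvg_trans cf => W /=; rewrite /nbhs /= => -[r r_gt0 rW].
exists (Num.min r e); first by rewrite /= lt_min r_gt0.
move=> t /= t_lt t_gt0; move: t_lt; rewrite lt_min => /andP[tr te].
apply: rW => //=; rewrite in_itv /= ltW //=.
by move: te; rewrite sub0r normrN gtr0_norm.
Qed.

Lemma edge_mx_translate (R : realType) (n d : nat) (P : 'I_n.+1 -> 'rV[R]_d)
    (p : 'rV[R]_d) :
  edge_mx (fun i => P i - p) = edge_mx P.
Proof. by apply/row_matrixP => k; rewrite !rowK opprB addrA subrK. Qed.

Lemma in_affine_subspace_translate (R : realType) (k m d : nat)
    (P : 'I_m -> 'rV[R]_d) (p : 'rV[R]_d) :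
  in_affine_subspace k (fun i => P i - p) -> in_affine_subspace k P.
Proof.
move=> [q [W [rW subW]]]; exists (q + p), W; split=> // i.
by rewrite opprD addrCA addrC; exact: subW.
Qed.

Theorem theorem1p5 (R : realType) (n d : nat) (hn : (2 <= n)%N)
    (hd : (n.+1 <= d)%N)
    (A : 'I_n.+2 -> 'rV[R]_d)
    (hA : degenerate_simplex A) (hAf : nondegenerate_faces A)
    (X1 X2 : {set 'I_n.+2}) (hX : natural_partition A X1 X2)
    (A' B : 'I_n.+2 -> 'rV[R]_n)
    (hA' : restricted_to A A') (hB : is_dual A' B)
    (hBs : ~ on_sphere B)
    (eps : R) (heps : 0 < eps)
    (At : R -> 'I_n.+2 -> 'rV[R]_d)
    (hcont : forall i, {within `[0, eps[, continuous (fun t => At t i)})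
    (hAt0 : forall i, At 0 i = A i)
    (hAtf : forall t, 0 <= t < eps -> nondegenerate_faces (At t))
    (hvol : forall t, 0 <= t < eps ->
       \sum_(i in X1) simplex_volume (face (At t) i)
       - \sum_(i in X2) simplex_volume (face (At t) i) = 0) :
  exists delta : R, 0 < delta <= eps /\
    forall t, 0 <= t < delta -> in_affine_subspace n (At t).
Proof.
have [p [U [UU AE]]] := hA'.
have [alpha [alpha0 alphaA alpha1 X2E sgP]] := hX.
(* Volumes and flatness are invariant under translation by [p], after which
   the initial configuration is the linear isometric image of [A']. *)
pose P t i := At t i - p.
have P0 i : P 0 i = A' i *m U by rewrite /P hAt0 AE addrC addKr.
have A'U i : A' i *m U = A i - p by rewrite AE addrC addKr.
have alphaA' : \sum_i alpha i *: A' i = 0.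
  have : (\sum_i alpha i *: A' i) *m U = 0.
    rewrite mulmx_suml; under eq_bigr do rewrite -scalemxAl A'U scalerBr.
    by rewrite sumrB alphaA -scaler_suml alpha1 scale0r subrr.
  by move=> /(congr1 (mulmx^~ U^T)); rewrite /= mul0mx -mulmxA UU mulmx1.
have indA' : affinely_independent (face A' ord0).
  move=> c c1 cA; apply: (hAf ord0) => //.
  rewrite /face; under eq_bigr do rewrite AE scalerDr scalemxAl.
  by rewrite big_split /= -scaler_suml c1 scale0r add0r -mulmx_suml cA mul0mx.
have [unitK' detK' sq0' foot' sum0'] :=
  flat_configuration hn indA' alpha0 alphaA' alpha1 hB hBs.
have [KE footE sqE] := bordered_gram_isometry UU P0.
rewrite -KE in unitK' detK' sum0'; rewrite -sqE in sq0'.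
rewrite -footE in foot' sum0'.
(* One-sided limits suffice: at [t = 0] itself the points are degenerate by
   assumption. *)
have cP i : mx_cvg 0^'+ (P ^~ i) (P 0 i).
  move=> a b; rewrite ord1 /P !mxE; under eq_cvg do rewrite !mxE.
  apply: cvgB; last exact: cvg_cst.
  exact: (cvg_comp _ _ (within_itv_cvg_at_right heps (hcont i))
    (@coord_continuous _ _ _ 0 b (At 0 i))).
have cK : mx_cvg 0^'+ (fun t => base_gram (P t)) (base_gram (P 0)).
  exact: mx_cvg_base_gram.
have volE t i : simplex_volume (face (At t) i) =
    Num.sqrt (\det (edge_mx (face (P t) i) *m (edge_mx (face (P t) i))^T))
      / n`!%:R.
  by rewrite /simplex_volume /face (edge_mx_translate (face (At t) i)).
have near_unit : \forall t \near 0^'+, base_gram (P t) \in unitmx.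
  have det0 : \det (base_gram (P 0)) != 0 by rewrite -unitfE -unitmxE.
  have : \forall t \near 0^'+, \det (base_gram (P t)) != 0.
    by exact: (cvgr_neq0 _ (cvg_det cK)).
  by apply: filterS => t; rewrite unitmxE unitfE.
have near_eps : \forall t \near 0^'+, 0 <= t < eps.
  near=> t; apply/andP; split=> //; near: t; exact: nbhs_right_lt.
have flat : \forall t \near 0^'+, sq_height (P t) = 0.
  apply: (flat_of_first_order
    (x := fun i t => foot (P t) 0 (rshift 1 i))
    (Q := fun i t => - cofactor (base_gram (P t)) (rshift 1 i) (rshift 1 i))
    (D := fun t => - \det (base_gram (P t))) (s := fun t => sq_height (P t))
    _ _ _ _ _ detK' _ sum0').
  - by move=> i; apply: mx_cvg_foot.
  - by move=> i; apply: cvgN; exact: cvg_cofactor.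
  - by apply: cvgN; exact: cvg_det.
  - rewrite -[X in _ --> X]sq0'; exact: cvg_sq_height.
  - by move=> i; rewrite foot' mulf_neq0 ?oppr_eq0 ?invr_eq0.
  - by apply: filterS near_unit => t; exact: foot_sum.
  near=> t.
  have unitt : base_gram (P t) \in unitmx by exact: (near near_unit t).
  have t_eps : 0 <= t < eps by exact: (near near_eps t).
  have := partition_balance alpha0 X2E sgP (hvol t t_eps).
  rewrite volE gram_base_face => V0.
  have fact_neq0 : n`!%:R != 0 :> R by rewrite pnatr_eq0 -lt0n fact_gt0.
  apply: (mulIf (invr_neq0 fact_neq0)); rewrite V0 mulr_suml.
  apply: eq_bigr => i _.
  by rewrite foot' volE gram_apex_face_foot // mulrA.
have [e e_gt0 eP] : exists2 e, 0 < e &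
    forall t, 0 < t < e -> sq_height (P t) = 0 /\ base_gram (P t) \in unitmx.
  have [e /= e_gt0 eP] := filterI flat near_unit.
  exists e => // t /andP[t_gt0 te]; apply: eP => //=.
  by rewrite sub0r normrN gtr0_norm.
exists (Num.min e eps); split.
  by rewrite lt_min e_gt0 heps ge_min lexx orbT.
move=> t /andP[]; rewrite le_eqVlt lt_min => /predU1P[<- _|t_gt0 /andP[te _]].
  have -> : At 0 = A by apply/funext.
  exact: hA.
apply: (@in_affine_subspace_translate _ _ _ _ _ p).
have [sq0 unitt] := eP t ltac:(by rewrite t_gt0 te).
exact: sq_height_degenerate.
Unshelve. all: by end_near. Qed.
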